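(* Let $\lambda$ be an infinite cardinal. Then a graph $G$ admits a $\lambda$-decomposition if and only if it admits both a $\lambda$-packing and a $\lambda$-covering.
   Context: Graphs may be infinite and may have parallel edges, but have no loops. A spanning tree of a graph $G$ is a connected, acyclic subgraph $T\subseteq G$ containing all vertices of $G$. For a cardinal $\lambda$: a $\lambda$-packing of $G$ is a collection of $\lambda$ many pairwise edge-disjoint spanning trees of $G$; a $\lambda$-covering of $G$ is a collection of $\lambda$ many spanning trees of $G$ whose union covers the edge set of $G$; a $\lambda$-decomposition of $G$ is a collection of $\lambda$ many spanning trees of $G$ whose edge sets partition the edge set of $G$. *)

(* Defs.v *)
From mathcomp Require Import all_boot.
From mathcomp Require Import boolp classical_sets functions cardinality.
From Stdlib Require Import Relation_Operators.

Set Implicit Arguments.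
Unset Strict Implicit.
Unset Printing Implicit Defensive.

Local Open Scope classical_set_scope.

(* Parallel edges are allowed because [ends] need not be injective; loops are
   excluded because every edge has two distinct ends. *)
Record multigraph := Multigraph {
  vertex : Type;
  edge : Type;
  ends : edge -> set vertex;
  endsP : forall e, exists x y : vertex, x <> y /\ ends e = [set x; y]
}.

Record subgraph (G : multigraph) := Subgraph {
  sverts : set (vertex G);
  sedges : set (edge G);
  sends : forall e, sedges e -> ends e `<=` sverts
}.

Section SpanningTrees.
Variable G : multigraph.
Implicit Type T : subgraph G.

Definition adjacent T (x y : vertex G) : Prop :=
  exists2 e, sedges T e & ends e = [set x; y].

(* The graph without vertices is not regarded as connected. *)
Definition connected_subgraph T : Prop :=
  sverts T !=set0 /\
  forall x y, sverts T x -> sverts T y ->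
    clos_refl_trans (vertex G) (adjacent T) x y.

(* Indices are cyclic: [ordS i] is the successor of [i] modulo n.  A pair of
   parallel edges is a cycle of length n = 2; for that length, injectivity of
   [e] is what prevents a single edge from counting as a cycle. *)
Definition is_cycle T n (v : 'I_n -> vertex G) (e : 'I_n -> edge G) : Prop :=
  [/\ 1 < n, injective v, injective e &
      forall i, sedges T (e i) /\ ends (e i) = [set v i; v (ordS i)]].

Definition acyclic T : Prop :=
  ~ exists n (v : 'I_n -> vertex G) (e : 'I_n -> edge G), is_cycle T v e.

Definition spanning_tree T : Prop :=
  [/\ sverts T = setT, connected_subgraph T & acyclic T].

End SpanningTrees.

(* A cardinal is represented by a type [L] of that cardinality, and a
   collection of that many trees by a family indexed by [L].  Repetitions are
   thus possible in a covering.  In a packing or a decomposition they can occur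
   only for the one-vertex graph, whose spanning tree has no edges; this is why
   the parts of a decomposition are not required to be nonempty, unlike in
   [classical_sets.partition]. *)
Section Families.
Variables (L : Type) (G : multigraph) (T : L -> subgraph G).

Definition is_packing : Prop :=
  (forall i, spanning_tree (T i)) /\ trivIset setT (fun i => sedges (T i)).

Definition is_covering : Prop :=
  (forall i, spanning_tree (T i)) /\ \bigcup_i sedges (T i) = setT.

Definition is_decomposition : Prop :=
  [/\ forall i, spanning_tree (T i),
      trivIset setT (fun i => sedges (T i)) &
      \bigcup_i sedges (T i) = setT].

End Families.

Definition has_packing (L : Type) (G : multigraph) : Prop :=
  exists T : L -> subgraph G, is_packing T.

Definition has_covering (L : Type) (G : multigraph) : Prop :=
  exists T : L -> subgraph G, is_covering T.

Definition has_decomposition (L : Type) (G : multigraph) : Prop :=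
  exists T : L -> subgraph G, is_decomposition T.

(* Main.v *)
Require Import Defs.
From mathcomp Require Import all_boot.
From mathcomp Require Import boolp classical_sets functions cardinality.
From Stdlib Require Import Relation_Operators.

Local Open Scope classical_set_scope.

(* Since L and L * nat are equipotent, the packing may be indexed by L * nat.
   Give every edge that no tree of the packing uses to one index l whose
   covering tree contains it, so that l receives a forest U.  It suffices, for
   each l separately, to decompose the union of U and the trees T 0, T 1, ...
   of index l into countably many spanning trees.  Extend U, within its union
   with T 0, to a spanning tree S 0.  The edges of T 0 outside S 0 again form a
   forest; extend it, within its union with T 1, to S 1, and so on: every edge
   ends up in exactly one of the trees S n. *)

(** * Equipotence of an infinite type [L] with [L * nat] *)

(** A maximal family of injective sequences with disjoint ranges misses only finitely many points of
    [L], and each sequence has room for countably many copies of its own positions. *)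
Lemma infinite_type_prod_nat_inj {L : Type} :
  infinite_set [set: L] -> exists f : L * nat -> L, injective f.
Proof.
move=> hL.
have [E [Einj Edisj Emax]] := ex_maximal_disjoint_subcollection
  (fun s : nat -> L => range s) [set s | injective s].
pose R := \bigcup_(s in E) range s.
have finRC : finite_set (~` R).
  (* An infinite complement would contain the range of an injective sequence [s], which could be
     added to [E]. *)
  apply: contrapT => /infiniteP/card_leP[h].
  have [s sinj sR] : exists2 s : nat -> L, injective s & forall n, ~ R (s n).
    exists (fun n => val (h (SigSub (mem_set (I : [set: nat] n))))).
      by move=> m n /val_inj/(@inj _ _ _ h) -/(_ (mem_set I) (mem_set I)) [].
    by move=> n; exact: set_mem (valP (h (SigSub (mem_set (I : [set: nat] n))))).
  apply: (Emax (E `|` [set s])).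
  - split=> [|/(_ s (or_intror erefl)) Es]; first exact: subsetUl.
    by apply: (sR 0); exists s => //; exists 0.
  - by move=> _ [/Einj//|->].
  - move=> s1 s2 /= [E1|->] [E2|->] [x [s1x s2x]] //.
    + by apply: Edisj => //; exists x.
    + by case: s2x => n _ nx; case: (sR n); rewrite nx; exists s1.
    + by case: s1x => n _ nx; case: (sR n); rewrite nx; exists s2.
have [s0 Es0] : E !=set0.
  apply/set0P/eqP => E0; apply: hL.
  by apply: sub_finite_set finRC => x _ [s]; rewrite E0.
have /countable_injP[j jinj] := finite_set_countable finRC.
(* [x] is coded by a position in a sequence of the family: even positions of
   [s0] are reserved for the elements that the family misses. *)
have codeP x : exists c : (nat -> L) * nat, E c.1 /\
    ((R x /\ exists2 k, c.2 = k.*2.+1 & c.1 k = x) \/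
     (~ R x /\ c = (s0, (j x).*2))).
  have [Rx|nRx] := pselect (R x); last by exists (s0, (j x).*2); split=> //; right.
  case: (Rx) => s Es [k _ skx]; exists (s, k.*2.+1); split=> //; left.
  by split=> //; exists k.
have /choice[code codeE] := codeP.
have code_inj : injective code.
  move=> x y xy; have [_] := codeE x; have [_] := codeE y; rewrite xy.
  case=> [[Ry [k ck ky]]|[nRy cy]] [[Rx [l cl lx]]|[nRx cx]].
  - by move: cl; rewrite ck -ky -lx => -[/double_inj ->].
  - by move: ck; rewrite cx /= => /(congr1 odd); rewrite /= !odd_double.
  - by move: cl; rewrite cy /= => /(congr1 odd); rewrite /= !odd_double.
  - by move: cy; rewrite cx => -[/double_inj/jinj]; apply; apply/mem_set.
(* The image of [(x, m)] stays in the sequence that codes [x]: disjointness of the ranges gives back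
   the sequence, and injectivity then the position and [m]. *)
exists (fun p => (code p.1).1 (pickle ((code p.1).2, p.2))).
move=> [x m] [y n] /= e.
have [Ex _] := codeE x; have [Ey _] := codeE y.
have exy : (code x).1 = (code y).1.
  apply: Edisj => //; exists ((code x).1 (pickle ((code x).2, m))).
  by split; [exact: imageT | rewrite e; exact: imageT].
move: e; rewrite exy => /(Einj _ Ey)/(pcan_inj pickleK)[ck ->].
by rewrite (code_inj x y) // [LHS]surjective_pairing exy ck -surjective_pairing.
Qed.

Lemma infinite_type_prod_nat_bij {L : Type} :
  infinite_set [set: L] -> exists f : L -> L * nat, bijective f.
Proof.
elim/Ppointed: L => [L|L] hL.
  by case: hL; rewrite emptyE; exact: finite_set0.
have [f finj] := infinite_type_prod_nat_inj hL.
have /card_set_bijP[g gbij] : ([set: L] #= [set: L * nat])%card.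
  apply: Cantor_Bernstein; apply/pcard_injP.
    by exists (fun x => (x, 0)) => x y _ _ [].
  by exists f => x y _ _ /finj.
by exists g; rewrite -setTT_bijective.
Qed.

(** Meant for a cycle in the union of a chain: among the finitely many members that contain its
    edges, the largest contains them all. *)
Lemma chain_finite_bound {T : Type} {F : set (set T)} {n : nat}
    (Q : 'I_n -> set T -> Prop) :
  (forall i X Y, X `<=` Y -> Q i X -> Q i Y) ->
  F !=set0 -> total_on F subset -> (forall i, exists2 X, F X & Q i X) ->
  exists2 X, F X & forall i, Q i X.
Proof.
move=> Qmono [X0 FX0] Ftot QF.
suff /(_ n (leqnn n))[X FX QX] : forall k, k <= n ->
    exists2 X, F X & forall i : 'I_n, i < k -> Q i X.
  by exists X => // i; exact: QX.
elim=> [|k IH] kn; first by exists X0.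
have [X FX QX] := IH (ltnW kn).
have [Y FY QY] := QF (Ordinal kn).
have [XY|YX] := Ftot _ _ FX FY; [exists Y | exists X] => // i.
  rewrite ltnS leq_eqVlt => /predU1P[ik|/QX]; last exact: Qmono.
  by rewrite (_ : i = Ordinal kn) //; exact: val_inj.
rewrite ltnS leq_eqVlt => /predU1P[ik|/QX //].
by rewrite (_ : i = Ordinal kn); [exact: Qmono QY | exact: val_inj].
Qed.

Lemma val_iter_ordS n k (i : 'I_n) : iter k (@ordS n) i = (i + k) %% n :> nat.
Proof.
elim: k => [|k IH]; first by rewrite addn0 modn_small.
by rewrite iterS /= IH -addn1 modnDml addn1 addnS.
Qed.

(** * Linking, cycles and forests in terms of edge sets *)

Section EdgeSets.
Variable G : multigraph.
Implicit Types (F U W A : set (edge G)) (T : subgraph G).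

Definition spanning_subgraph F : subgraph G :=
  @Subgraph G setT F (fun _ _ => @subsetT _ _).

Definition linked F := clos_refl_trans (vertex G) (adjacent (spanning_subgraph F)).

Lemma spanning_treeE T :
  spanning_tree T <-> sverts T = setT /\ spanning_tree (spanning_subgraph (sedges T)).
Proof.
split=> [[TT [T0 Tconn] Tac]|[TT [_ [T0 Tconn] Tac]]]; do ?split=> //.
- by have [x _] := T0; exists x.
- by move=> x y _ _; apply: Tconn; rewrite TT.
- by have [x _] := T0; exists x; rewrite TT.
- by move=> x y _ _; exact: Tconn.
Qed.

Lemma linked_sym F x y : linked F x y -> linked F y x.
Proof.
elim=> [{}x {}y [e Fe exy]|{}x|{}x {}y z _ yx _ zy].
- by apply: rt_step; exists e => //; rewrite exy setUC.
- exact: rt_refl.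
- exact: rt_trans zy yx.
Qed.

Lemma linked_edge F e x y : F e -> ends e = [set x; y] -> linked F x y.
Proof. by move=> Fe exy; apply: rt_step; exists e. Qed.

Lemma linked_trans F W :
  (forall e x y, W e -> ends e = [set x; y] -> linked F x y) ->
  forall x y, linked W x y -> linked F x y.
Proof.
move=> WF x y; elim=> [{}x {}y [e We exy]|{}x|{}x {}y z _ xy _ yz].
- exact: WF exy.
- exact: rt_refl.
- exact: rt_trans xy yz.
Qed.

Lemma linked_sub F W : F `<=` W -> forall x y, linked F x y -> linked W x y.
Proof. by move=> FW; apply: linked_trans => e x y /FW; exact: linked_edge. Qed.

(** The other edges of the cycle lead from [v (ordS j)] the long way round to [v j]. *)
Lemma cycle_arc_linked F n (v : 'I_n -> vertex G) (e : 'I_n -> edge G) j :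
  is_cycle (spanning_subgraph F) v e ->
  linked (F `\ e j) (v (ordS j)) (v j).
Proof.
case=> n1 vinj einj vE.
have arc k : k < n -> linked (F `\ e j) (v (ordS j)) (v (iter k.+1 (@ordS n) j)).
  elim: k => [|k IH] kn; first exact: rt_refl.
  apply: rt_trans (IH (ltnW kn)) _.
  have [Fe ee] := vE (iter k.+1 (@ordS n) j).
  (* If this edge were [e j], then [n] would divide [k.+1], which is smaller than [n]. *)
  apply: (linked_edge _ _ _ _ _ ee); split=> // /einj eqj.
  have := val_iter_ordS n k.+1 j; rewrite eqj => jk.
  have /eqP : j + k.+1 = j + 0 %[mod n] by rewrite -jk addn0 modn_small.
  by rewrite eqn_modDl mod0n modn_small.
have {arc} := arc n.-1; rewrite prednK ?(ltnW n1) // => /(_ (leqnn _)).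
rewrite (_ : iter n _ j = j) //; apply: val_inj.
by rewrite /= val_iter_ordS modnDr modn_small.
Qed.

Lemma acyclic_sub F W : F `<=` W ->
  acyclic (spanning_subgraph W) -> acyclic (spanning_subgraph F).
Proof.
move=> FW acW [n [v [e [n1 vinj einj vE]]]]; apply: acW.
by exists n, v, e; split=> // i; have [/FW] := vE i.
Qed.

(** A new cycle would have to use [e], and its other edges would link [x] and [y] within [F]. *)
Lemma acyclic_setU1 F e x y :
  acyclic (spanning_subgraph F) -> ends e = [set x; y] -> ~ linked F x y ->
  acyclic (spanning_subgraph (F `|` [set e])).
Proof.
move=> acF exy nxy [n [v [f cyc]]]; have [n1 vinj finj vE] := cyc.
have [[j fj]|nf] := pselect (exists j, f j = e); last first.
  apply: acF; exists n, v, f; split=> // i; have [fF fE] := vE i.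
  by split=> //; case: fF => // fi; case: nf; exists i.
have lj : linked F (v (ordS j)) (v j).
  apply: linked_sub (cycle_arc_linked _ _ _ _ j cyc) => g [Fg gj].
  by case: Fg => // ge; case: gj; rewrite ge fj.
apply: nxy; have [_] := vE j; rewrite fj exy => E.
have : [set v j; v (ordS j)] x by rewrite -E; left.
have : [set v j; v (ordS j)] y by rewrite -E; right.
have : [set x; y] (v j) by rewrite E; left.
have : [set x; y] (v (ordS j)) by rewrite E; right.
have lj' := linked_sym _ _ _ lj.
by move=> _ _ [->|->] [->|->] //; exact: rt_refl.
Qed.

Lemma spanning_tree_between U W : U `<=` W ->
  acyclic (spanning_subgraph U) -> connected_subgraph (spanning_subgraph W) ->
  exists F, [/\ U `<=` F, F `<=` W & spanning_tree (spanning_subgraph F)].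
Proof.
move=> UW acU [V0 connW].
(* The union of the empty chain is empty, so [U] is joined to [A] rather than required to lie in
   it. *)
pose P A := A `<=` W /\ acyclic (spanning_subgraph (A `|` U)).
have [C CP Ctot|A [[AW acA] Amax]] := @Zorn_bigcup _ P.
  split=> [e [X /CP[XW _]]|]; first exact: XW.
  have [->|/set0P C0] := eqVneq C set0; first by rewrite bigcup_set0 set0U.
  move=> [n [v [e [n1 vinj einj vE]]]].
  have [i X Y XY [/XY|]||||X CX eX] :=
      @chain_finite_bound _ C n (fun i X => (X `|` U) (e i)).
  - by left.
  - by right.
  - exact: C0.
  - exact: Ctot.
  - move=> i; have [[[X CX Xe]|Ue] _] := vE i; first by exists X => //; left.
    by have [X CX] := C0; exists X => //; right.
  - have [_] := CP _ CX; apply; exists n, v, e; split=> // i.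
    by have [_ eE] := vE i; split=> //; exact: eX.
exists (A `|` U); split; [exact: subsetUr | by rewrite subUset |].
split=> //; split=> // x y _ _.
(* An edge of [W] with unlinked ends could be added to [A] without closing a cycle, against
   maximality. *)
apply: linked_trans (connW x y I I) => {x y} e x y We exy.
apply: contrapT => nxy.
have [Ae|nAe] := pselect (A e).
  by apply/nxy/(linked_edge _ _ _ _ _ exy); left.
apply: (Amax (A `|` [set e])).
  by split=> [|/(_ e (or_intror erefl))//]; exact: subsetUl.
split; first by move=> f [/AW|->].
by rewrite setUAC; exact: acyclic_setU1 nxy.
Qed.

(** * Absorption of a forest by countably many disjoint trees *)

Lemma countable_absorption (T : nat -> set (edge G)) U :
  (forall n, spanning_tree (spanning_subgraph (T n))) ->
  trivIset setT T -> acyclic (spanning_subgraph U) ->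
  (forall n, U `&` T n = set0) ->
  exists S : nat -> set (edge G),
    [/\ forall n, spanning_tree (spanning_subgraph (S n)), trivIset setT S &
        \bigcup_n S n = U `|` \bigcup_n T n].
Proof.
move=> treeT disjT acU UT.
(* Acyclicity is assumed under the quantifier, with default [set0], so that [step] is total and
   [rest] can be defined before it is known to consist of forests. *)
have /choice[step stepP] : forall p, exists S, acyclic (spanning_subgraph p.2) ->
    [/\ p.2 `<=` S, S `<=` p.2 `|` T p.1 & spanning_tree (spanning_subgraph S)].
  move=> [n F] /=.
  have [acF|] := pselect (acyclic (spanning_subgraph F)); last by exists set0.
  have [_ [V0 connT] _] := treeT n.
  have [||S [FS SFT treeS]] := spanning_tree_between F (F `|` T n) _ acF.
  - exact: subsetUl.
  - split=> // x y _ _; apply: linked_sub (connT x y I I); exact: subsetUr.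
  - by exists S.
pose rest := fix rest n :=
  if n is m.+1 then T m `\` step (m, rest m) else U.
pose S n := step (n, rest n).
have acR n : acyclic (spanning_subgraph (rest n)).
  case: n => //= n; have [_ _] := treeT n; apply: acyclic_sub.
  exact: subDsetl.
have SP n : [/\ rest n `<=` S n, S n `<=` rest n `|` T n &
    spanning_tree (spanning_subgraph (S n))] by exact: (stepP (n, rest n) (acR n)).
(* [rest n] comes from [U] or from the preceding tree [T n.-1], hence avoids all later trees. *)
have restT n m e : n <= m -> rest n e -> ~ T m e.
  case: n => [|n] nm /= Re Te; first by have : (U `&` T m) e by []; rewrite UT.
  have nm' : n = m by apply: disjT => //; exists e; split=> //; case: Re.
  by rewrite nm' ltnn in nm.
have restR n m e : n < m -> rest m e -> ~ rest n e.
  by case: m => // m nm [Te _] Rn; exact: (restT n m e nm Rn Te).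
have disjS n m e : n < m -> S n e -> ~ S m e.
  move=> nm Sn Sm.
  have [_ /(_ _ Sm) [Rm|Tm] _] := SP m; have [_ /(_ _ Sn) [Rn|Tn] _] := SP n.
  - exact: restR Rm Rn.
  (* The critical case of consecutive stages: [rest m.+1] omits what [S m] has taken. *)
  - case: m nm Rm {Sm} => // m nm [Tm nSm].
    have /esym mn : n = m by apply: disjT => //; exists e.
    by apply: nSm; rewrite mn.
  - exact: restT (ltnW nm) Rn Tm.
  - have mn : n = m by apply: disjT => //; exists e.
    by rewrite mn ltnn in nm.
exists S; split=> [n||].
- by have [] := SP n.
- move=> n m _ _ [e [Sn Sm]]; case: (ltngtP n m) => // nm.
    by case: (disjS _ _ _ nm Sn).
  by case: (disjS _ _ _ nm Sm).
- apply/seteqP; split=> e.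
    move=> [n _ Se]; have [_ /(_ _ Se)[Re|Te] _] := SP n.
      by case: n Re {Se} => [|n] /=; [left | move=> [Te _]; right; exists n].
    by right; exists n.
  case=> [Ue|[n _ Te]]; first by exists 0 => //; have [+ _ _] := SP 0; exact.
  (* What [S n] misses of [T n] is [rest n.+1], which [S n.+1] contains. *)
  have [Se|nSe] := pselect (S n e); first by exists n.
  by exists n.+1 => //; have [+ _ _] := SP n.+1; apply; split.
Qed.

End EdgeSets.

Arguments spanning_subgraph {G} F.

(** * Distribution of all edges among the indices in [L] *)

Theorem theorem1p1 (L : Type) (hL : infinite_set [set: L]) (G : multigraph) :
  has_decomposition L G <-> has_packing L G /\ has_covering L G.
Proof.
split=> [[T [treeT disjT covT]]|]; first by split; exists T.
move=> [[T [treeT disjT]] [C [treeC covC]]].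
have [g gbij] := infinite_type_prod_nat_bij hL; have [f fK gK] := gbij.
have finj : injective f by exact: can_inj gK.
have /choice[c cP] : forall e, exists l, sedges (C l) e.
  by move=> e; have : (\bigcup_l sedges (C l)) e; [rewrite covC | case=> l _; exists l].
pose U l := [set e | c e = l /\ forall p, ~ sedges (T (f p)) e].
have /choice[S SP] : forall l, exists S : nat -> set (edge G),
    [/\ forall n, spanning_tree (spanning_subgraph (S n)), trivIset setT S &
        \bigcup_n S n = U l `|` \bigcup_n sedges (T (f (l, n)))].
  move=> l; apply: countable_absorption.
  - by move=> n; have /spanning_treeE[] := treeT (f (l, n)).
  - by move=> m n _ _ [e [me ne]]; have /finj[] : f (l, m) = f (l, n) by apply: disjT => //; exists e.
  - have /spanning_treeE[_ [_ _]] := treeC l; apply: acyclic_sub => e [<- _].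
    exact: cP.
  - by move=> n; rewrite -subset0 => e [[_ /(_ (l, n))]].
exists (fun l => spanning_subgraph (S (g l).1 (g l).2)); split=> [l||].
- by have [] := SP (g l).1.
- move=> l l' _ _ [e [/= Se Se']].
  have inS k n : S k n e -> (U k `|` \bigcup_n sedges (T (f (k, n)))) e.
    by have [_ _ <-] := SP k; exists n.
  (* An edge determines its first index: through [c] if the packing misses it, and otherwise through
     the one packing tree that contains it. *)
  have kk' : (g l).1 = (g l').1.
    case: (inS _ _ Se) (inS _ _ Se') => [[cl nT]|[n _ Te]] [[cl' nT']|[n' _ Te']].
    - by rewrite -cl -cl'.
    - by case: (nT _ Te').
    - by case: (nT' _ Te).
    - by have /finj[] : f ((g l).1, n) = f ((g l').1, n') by apply: disjT => //; exists e.
  apply: (can_inj fK); rewrite [LHS]surjective_pairing [RHS]surjective_pairing kk'.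
  congr pair; have [_ + _] := SP (g l').1; apply=> //.
  by exists e; split=> //; rewrite -kk'.
- rewrite -subTset => e _.
  suff [k [n Se]] : exists k n, S k n e by exists (f (k, n)) => //=; rewrite gK.
  have [[[k n] Te]|nT] := pselect (exists p, sedges (T (f p)) e).
    have [_ _ E] := SP k.
    by have [n' _ Se] : (\bigcup_n S k n) e; [rewrite E; right; exists n | exists k, n'].
  have [_ _ E] := SP (c e).
  have [n' _ Se] : (\bigcup_n S (c e) n) e; last by exists (c e), n'.
  by rewrite E; left; split=> // p Te; apply: nT; exists p.
Qed.
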